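(* For every positive integer $n$, $$\operatorname{disc}(n)\geq 2^{1-1/\lceil n/3\rceil},$$ where, as $n\to\infty$, $$2^{1-1/\lceil n/3\rceil}=2-\frac{6\ln 2}{n}-O\left(\frac1{n^2}\right).$$
   Context: For a partition $\mathcal I$ of $[0,1]$ into finitely many intervals (each of positive length, overlapping at most at endpoints), let $|I|$ denote the length of an interval $I$ and define $$\operatorname{disc}(\mathcal I)=\max_{I_1,I_2\in\mathcal I}\frac{|I_1|}{|I_2|}.$$ A strategy of length $n$ is a sequence $\mathcal S=(\mathcal I_1,\mathcal I_2,\dots,\mathcal I_n)$ such that $\mathcal I_i$ is a partition of $[0,1]$ into $i$ intervals for each $i$, and $\mathcal I_{i+1}$ is formed from $\mathcal I_i$ by dividing a single interval into two (for $1\le i\le n-1$). Define $$\operatorname{disc}(\mathcal S)=\max_{1\le t\le n}\operatorname{disc}(\mathcal I_t),\qquad \operatorname{disc}(n)=\min_{\mathcal S}\operatorname{disc}(\mathcal S),$$ where the minimum is over all strategies $\mathcal S$ of length $n$. In the claim, ''$-O(1/n^2)$'' denotes an error term whose absolute value is at most a constant times $1/n^2$. *)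

(* Defs.v *)
From HB Require Import structures.
From mathcomp Require Import all_boot all_order all_algebra finmap.
From mathcomp Require Import all_classical all_reals all_analysis.

Set Implicit Arguments.
Unset Strict Implicit.
Unset Printing Implicit Defensive.

Import Order.TTheory GRing.Theory Num.Theory.
Import numFieldNormedType.Exports.

Local Open Scope classical_set_scope.
Local Open Scope ring_scope.

Section Discrepancy.
Variable R : realType.

(* The interval [a, b] is encoded by its pair of endpoints (a, b). *)
Definition len (I : R * R) : R := I.2 - I.1.

Definition is_partition (P : {fset R * R}) : Prop :=
  [/\ forall I, I \in P -> I.1 < I.2,
      forall I J, I \in P -> J \in P -> I != J ->
        `]I.1, I.2[%classic `&` `]J.1, J.2[%classic = set0
    & \bigcup_(I in [set` P]) `[I.1, I.2]%classic = `[0, 1]%classic ].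

(* The ratios are positive, so the default value 0 of the iterated maximum
   never contributes on a (necessarily nonempty) partition. *)
Definition disc_partition (P : {fset R * R}) : R :=
  \big[Num.max/0]_(I <- P) \big[Num.max/0]_(J <- P) (len I / len J).

Definition splits (P Q : {fset R * R}) : Prop :=
  exists a c b : R, [/\ (a, b) \in P, a < c, c < b &
    Q = ([fset (a, c); (c, b)] `|` (P `\ (a, b)))%fset].

(* Indices are shifted by one: S t is the partition into t.+1 intervals. *)
Definition is_strategy (n : nat) (S : 'I_n -> {fset R * R}) : Prop :=
  [/\ forall t, is_partition (S t),
      forall t, #|` S t| = t.+1
    & forall t u : 'I_n, u = t.+1 :> nat -> splits (S t) (S u)].

Definition disc_strategy (n : nat) (S : 'I_n -> {fset R * R}) : R :=
  \big[Num.max/0]_(t < n) disc_partition (S t).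

(* The minimum over all strategies, taken as an infimum. For n > 0 it is
   attained: strategies of bounded discrepancy have interval lengths bounded
   away from 0, hence form a compact family. *)
Definition disc (n : nat) : R :=
  inf [set disc_strategy S | S in @is_strategy n].

End Discrepancy.

Arguments disc R n : clear implicits.

(* Main.v *)
(* Write D for the discrepancy of a strategy. Splitting an interval leaves a
   piece of at most half its length, hence the maximal length is multiplied by
   at most D / 2 at each step. Starting from a partition into m intervals and
   making m - 1 splits, the maximal length drops to at most (D / 2)^(m-1) times
   the initial one, which is at most D (D / 2)^(m-1) times the initial minimal
   one. But some interval of the initial partition has survived, so
   D (D / 2)^(m-1) >= 1, that is D >= 2^(1 - 1/m). This needs only
   2 m - 1 <= n, which m = ceil (n / 3) satisfies. *)

Require Import Defs.
From HB Require Import structures.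
From mathcomp Require Import all_boot all_order all_algebra finmap.
From mathcomp Require Import all_classical all_reals all_analysis.
From mathcomp Require Import zify ring lra.

Import Order.TTheory GRing.Theory Num.Theory.
Import numFieldNormedType.Exports.

Local Open Scope classical_set_scope.
Local Open Scope ring_scope.

(** * Splits preserve partitions; existence of strategies *)

Lemma in_splits {R : realType} {P : {fset R * R}} {a c b : R} (I : R * R) :
  (I \in ([fset (a, c); (c, b)] `|` (P `\ (a, b)))%fset) =
  [|| I == (a, c), I == (c, b) | (I != (a, b)) && (I \in P)].
Proof. by rewrite !inE orbA. Qed.

Lemma splits_partition {R : realType} {P Q : {fset R * R}} :
  is_partition P -> splits P Q -> is_partition Q /\ #|` Q| = #|` P|.+1.
Proof.
move=> [Ppos Pdisj Pcov] [a [c [b [abP ac cb ->]]]].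
have disj (I J : R * R) (x : R) : I \in P -> J \in P -> I != J ->
    I.1 < x < I.2 -> J.1 < x < J.2 -> False.
  move=> IP JP IJ xI xJ; have /seteqP [/(_ x) + _] := Pdisj _ _ IP JP IJ.
  by apply; split; rewrite /= in_itv.
have old (I : R * R) (x : R) : I \in P -> I != (a, b) ->
    I.1 < x < I.2 -> a < x < b -> False.
  by move=> IP Iab; exact: (disj I (a, b)).
rewrite /is_partition -Pcov {Pcov Pdisj}.
split; first split.
- move=> I; rewrite in_splits => /or3P[/eqP->//|/eqP->//|/andP[_]].
  exact: Ppos.
- move=> I J; rewrite !in_splits => HI HJ IJ.
  apply/seteqP; split=> [x /= []|//]; rewrite !in_itv /= => xI xJ.
  case/or3P: HI xI IJ => [/eqP->|/eqP->|/andP[Iab IP]] /=;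
    case/or3P: HJ xJ => [/eqP->|/eqP->|/andP[Jab JP]] /= xJ xI;
    rewrite ?eqxx // => IJ; try (exfalso; lra).
  + by apply: (old _ x JP Jab xJ); lra.
  + by apply: (old _ x JP Jab xJ); lra.
  + by apply: (old _ x IP Iab xI); lra.
  + by apply: (old _ x IP Iab xI); lra.
  + exact: (disj I J x).
- apply/seteqP; split=> x [I /=].
  + rewrite in_splits in_itv /= => /or3P[/eqP->|/eqP->|/andP[_ IP]] /= xI;
      [exists (a, b)|exists (a, b)|exists I] => //=; rewrite in_itv /=; lra.
  + rewrite in_itv /= => IP xI.
    have [Iab|Iab] := eqVneq I (a, b).
      rewrite Iab /= in xI; have [xc|cx] := leP x c.
        exists (a, c); rewrite /= ?in_splits ?eqxx // in_itv /=; lra.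
      exists (c, b); rewrite /= ?in_splits ?eqxx ?orbT // in_itv /=; lra.
    by exists I; rewrite /= ?in_splits ?Iab ?IP ?orbT // in_itv.
(* The midpoint of a proper piece of [(a, b)] would lie inside two members of [P]. So both halves
   are new, and the union of finite sets really gains one element. *)
have fresh (I : R * R) : I.1 < I.2 -> a <= I.1 -> I.2 <= b ->
    I != (a, b) -> I \notin P.
  move=> I12 aI Ib Iab; apply/negP => IP.
  by apply: (old I ((I.1 + I.2) / 2) IP Iab); lra.
have acP : (a, c) \notin P.
  by apply: fresh => //=; [lra|rewrite xpair_eqE eqxx /= lt_eqF].
have cbP : (c, b) \notin P.
  by apply: fresh => //=; [lra|rewrite xpair_eqE eqxx andbT /= gt_eqF].
rewrite -fsetUA !cardfsU1 (cardfsD1 (a, b) P) abP !inE.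
by rewrite (negPf acP) (negPf cbP) xpair_eqE (lt_eqF ac) !andbF.
Qed.

Lemma exists_splits {R : realType} {P : {fset R * R}} :
  is_partition P -> (0 < #|` P|)%N -> exists Q, splits P Q.
Proof.
move=> [Ppos _ _]; rewrite cardfs_gt0 => /fset0Pn [[a b] abP].
have := Ppos _ abP; rewrite /= => ab.
exists ([fset (a, (a + b) / 2); ((a + b) / 2, b)] `|` (P `\ (a, b)))%fset.
by exists a, ((a + b) / 2), b; split=> //; lra.
Qed.

Lemma is_partition1 (R : realType) : is_partition [fset ((0 : R), (1 : R))]%fset.
Proof.
split=> [I|I J|]; rewrite ?inE.
- by move/eqP->; rewrite /= ltr01.
- by move=> /eqP-> /eqP->; rewrite eqxx.
- apply/seteqP; split=> [x [I /=]|x x01]; first by rewrite inE => /eqP->.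
  by exists (0, 1) => //=; rewrite inE.
Qed.

(** A common lower bound for all strategies passes to the infimum in [disc] only over a nonempty
    set. *)
Lemma exists_strategy (R : realType) (n : nat) :
  exists S : 'I_n -> {fset R * R}, is_strategy S.
Proof.
(* Putting the conditions under the existential allows a total choice function; its value off
   nonempty partitions is arbitrary. *)
have step (P : {fset R * R}) : exists Q,
    is_partition P -> (0 < #|` P|)%N -> splits P Q.
  have [[PP P0]|nP] := pselect (is_partition P /\ (0 < #|` P|)%N).
    by have [Q PQ] := exists_splits PP P0; exists Q.
  by exists P => ? ?; case: nP.
have [f fP] := choice step.
pose F t := iter t f [fset ((0 : R), (1 : R))]%fset.
have FP t : is_partition (F t) /\ #|` F t| = t.+1.
  elim: t => [|t [PF cF]]; first by rewrite cardfs1; split=> //; exact: is_partition1.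
  have F0 : (0 < #|` F t|)%N by rewrite cF.
  by have [] := splits_partition PF (fP _ PF F0); rewrite cF.
exists (fun t => F t); split=> [t|t|t u ->]; [exact: (FP t).1|exact: (FP t).2|].
by apply: fP; rewrite ?(FP t).2 //; exact: (FP t).1.
Qed.

(** * Lengths and survivors along successive splits *)

Lemma len_le_disc_partition {R : realType} {P : {fset R * R}} {I J : R * R} :
  is_partition P -> I \in P -> J \in P -> len I <= disc_partition P * len J.
Proof.
move=> [Ppos _ _] IP JP.
rewrite -ler_pdivrMr ?subr_gt0 ?Ppos //.
apply: le_trans (le_bigmax_seq _ _ _ _ IP isT) => /=.
exact: (le_bigmax_seq _ _ (fun=> true) (fun J => len I / len J) JP isT).
Qed.

Lemma splits_exists_half {R : realType} {P Q : {fset R * R}} :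
  splits P Q -> exists I J, [/\ I \in P, J \in Q & len J <= len I / 2].
Proof.
move=> [a [c [b [abP ac cb ->]]]].
have [h|h] := leP (c - a) ((b - a) / 2).
  by exists (a, b), (a, c); rewrite in_splits eqxx.
exists (a, b), (c, b); rewrite in_splits eqxx orbT; split=> //.
by rewrite /len /=; lra.
Qed.

(** Only [(a, b)] is removed by a split. With [A] the initial partition, this counts the initial
    intervals still intact. *)
Lemma splits_card_survivors {R : realType} {P Q : {fset R * R}}
    (A : {fset R * R}) :
  splits P Q -> (#|` A `&` P| <= #|` A `&` Q|.+1)%fset%N.
Proof.
move=> [a [c [b [_ _ _ ->]]]].
rewrite (cardfsD1 (a, b)) -add1n leq_add ?leq_b1 //.
apply: fsubset_leq_card; apply/fsubsetP => I; rewrite !inE.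
by case/and3P=> -> -> ->; rewrite !orbT.
Qed.

Section SplittingSequence.
Variables (R : realType) (F : nat -> {fset R * R}) (D : R) (k : nat).
Hypothesis D_ge0 : 0 <= D.
Hypothesis FS : forall t, (t < k)%N -> splits (F t) (F t.+1).
Hypothesis FD : forall t I J, (t <= k)%N -> I \in F t -> J \in F t ->
  len I <= D * len J.

(* After a split, the smaller half is at most half of some previous interval,
   and every interval is at most D times as long as that half. *)
Lemma len_decay t I J : (t <= k)%N -> J \in F 0%N -> I \in F t ->
  len I <= D * (D / 2) ^+ t * len J.
Proof.
move=> + JF; elim: t I => [|t IH] I tk IF.
  by rewrite expr0 mulr1 (@FD 0).
have [I1 [I2 [I1F I2F I21]]] := splits_exists_half (FS _ tk).
have H1 := IH _ (ltnW tk) I1F.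
apply: le_trans (FD _ _ _ tk IF I2F) _.
rewrite exprS.
have -> : D * (D / 2 * (D / 2) ^+ t) * len J
   = D * ((D * (D / 2) ^+ t * len J) / 2) by field.
by apply: ler_wpM2l => //; apply: le_trans I21 _; lra.
Qed.

Lemma exists_survivor : (k < #|` F 0%N|)%N -> exists2 I, I \in F 0%N & I \in F k.
Proof.
move=> kF.
have card t : (t <= k)%N -> (#|` F 0%N| <= #|` F 0%N `&` F t|%fset + t)%N.
  elim: t => [|t IH] tk; first by rewrite fsetIid addn0.
  by have := IH (ltnW tk); have := splits_card_survivors (F 0%N) (FS _ tk); lia.
have /fset0Pn [I] : (F 0%N `&` F k)%fset != fset0.
  by rewrite -cardfs_gt0; have := card k (leqnn k); lia.
by rewrite inE => /andP[]; exists I.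
Qed.

(** For a survivor [I], [len_decay] has [len I] on both sides; cancelling it leaves
    [1 <= D * (D / 2) ^+ k]. *)
Lemma expr2_le_disc : (forall I, I \in F 0%N -> 0 < len I) ->
  (k < #|` F 0%N|)%N -> 2 ^+ k <= D ^+ k.+1.
Proof.
move=> Fpos /exists_survivor [I I0 Ik].
have := len_decay _ _ _ (leqnn k) I0 Ik.
rewrite -[X in X <= _]mul1r ler_pM2r ?Fpos //.
by rewrite expr_div_n mulrA -exprS ler_pdivlMr ?exprn_gt0 // mul1r.
Qed.

End SplittingSequence.

(** * The lower bound for strategies and for [disc] *)

Lemma disc_strategy_ge1 {R : realType} {n : nat} {S : 'I_n -> {fset R * R}} :
  (0 < n)%N -> is_strategy S -> 1 <= disc_strategy S.
Proof.
case: n S => [//|n] S _ [SP Scard _].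
have /fset0Pn [I IS] : S ord0 != fset0 by rewrite -cardfs_gt0 Scard.
have lI : 0 < len I by rewrite subr_gt0; have [+ _ _] := SP ord0; apply.
apply: (@le_trans _ _ (disc_partition (S ord0))).
  have := len_le_disc_partition (SP ord0) IS IS.
  by rewrite -[X in X <= _]mul1r ler_pM2r.
exact: (le_bigmax 0 (fun t => disc_partition (S t)) ord0).
Qed.

Lemma disc_strategy_expr_ge {R : realType} {n : nat}
    {S : 'I_n -> {fset R * R}} (m : nat) :
  is_strategy S -> (m.*2 < n)%N -> 2 ^+ m <= disc_strategy S ^+ m.+1.
Proof.
case: n S => [//|n] S HS mn; have D1 := disc_strategy_ge1 (ltn0Sn n) HS.
case: HS => SP Scard SS.
(* Index [m] holds the partition into [m.+1] intervals, so [m] splits leave a survivor. They end at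
   index [m.*2], a valid index as [m.*2 < n], so [inord] never takes its default value. *)
pose F t := S (inord (m + t)).
have FE t : (t <= m)%N -> (inord (m + t) : 'I_n.+1) = (m + t)%N :> nat.
  by move=> tm; rewrite inordK //; lia.
apply: (@expr2_le_disc _ F).
- exact: le_trans D1.
- by move=> t tm; apply: SS; rewrite !FE ?addnS // ltnW.
- move=> t I J tm IF JF.
  have lJ : 0 <= len J.
    by rewrite ltW // subr_gt0; have [+ _ _] := SP (inord (m + t)); apply.
  apply: le_trans (len_le_disc_partition (SP _) IF JF) _.
  apply: ler_wpM2r => //.
  exact: (le_bigmax 0 (fun t => disc_partition (S t))).
- by move=> I IF; rewrite subr_gt0; have [+ _ _] := SP (inord (m + 0)); apply.
- by rewrite Scard FE // addn0.
Qed.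

Lemma powR_le_disc (R : realType) (n m : nat) : (m.*2 < n)%N ->
  2 `^ (1 - 1 / m.+1%:R) <= disc R n.
Proof.
move=> mn; apply: lb_le_inf.
  by have [S HS] := exists_strategy R n; exists (disc_strategy S), S.
move=> _ [S HS <-].
have D1 : 1 <= disc_strategy S by apply: disc_strategy_ge1 HS; lia.
have D0 : 0 <= disc_strategy S by apply: le_trans D1.
have := disc_strategy_expr_ge m HS mn.
(* Taking the root of order [m.+1] on both sides. *)
rewrite -!powR_mulrn // => /(@ge0_ler_powR _ m.+1%:R^-1 _ _ _).
rewrite -!powRrM mulfV ?pnatr_eq0 // powRr1 // => H.
have -> : 1 - 1 / m.+1%:R = m%:R / m.+1%:R :> R.
  by rewrite -natr1; field; rewrite natr1 pnatr_eq0.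
by apply: H; rewrite ?invr_ge0 ?ler0n // nnegrE powR_ge0.
Qed.

(** * The ceiling and the asymptotic expansion *)

Lemma ceil_div3 (R : realType) (n : nat) :
  Num.ceil (n%:R / 3 : R) = ((n + 2) %/ 3)%:Z.
Proof.
apply: ceil_def; set q := ((n + 2) %/ 3)%N.
(* From [n <= 3 q <= n + 2] follows [q - 1 < n / 3 <= q], which characterizes the ceiling. *)
have h1 : (q * 3)%:R <= (n + 2)%:R :> R by rewrite ler_nat /q; lia.
have h2 : n%:R <= (q * 3)%:R :> R by rewrite ler_nat /q; lia.
by move: h1 h2; rewrite rmorphB /= natrM natrD -!pmulrn => h1 h2; lra.
Qed.

(** The tangent at 0 gives the lower side. For the upper side, [expR (- x)] is at most
    [1 / (1 + x)], and [(1 - x + x^2) (1 + x) = 1 + x^3 >= 1]. *)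
Lemma expRN_bound (R : realType) (x : R) :
  0 <= x -> `| expR (- x) - (1 - x) | <= x ^+ 2.
Proof.
move=> x0.
have lo : 1 - x <= expR (- x) by exact: expR_ge1Dx.
have hi : expR (- x) <= 1 - x + x ^+ 2.
  rewrite expRN; apply: (@le_trans _ _ (1 + x)^-1).
    by rewrite lef_pV2 ?posrE ?expR_gt0 ?expR_ge1Dx //; lra.
  rewrite -[X in X <= _]mul1r ler_pdivrMr; last lra.
  have -> : (1 - x + x ^+ 2) * (1 + x) = 1 + x ^+ 3 by ring.
  by rewrite lerDl exprn_ge0.
by rewrite ger0_norm; lra.
Qed.

Theorem theorem1p3 (R : realType) :
  (forall n : nat, (0 < n)%N ->
     disc R n >= 2 `^ (1 - 1 / (Num.ceil (n%:R / 3 : R))%:~R)) /\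
  (exists C : R, \forall n \near \oo,
     `| 2 `^ (1 - 1 / (Num.ceil (n%:R / 3 : R))%:~R)
        - (2 - 6 * ln 2 / n%:R) | <= C * (1 / n%:R ^+ 2)).
Proof.
split=> [n n0|].
  rewrite ceil_div3 -pmulrn.
  (* With [q] the quotient and [m = q - 1], the bounds [3 q <= n + 2] and [q >= 1] give
     [2 m < n]. *)
  have -> : ((n + 2) %/ 3 = ((n + 2) %/ 3).-1.+1)%N by lia.
  by apply: powR_le_disc; lia.
set l : R := ln 2.
have l0 : 0 <= l by rewrite ln_ge0 // ler1n.
(* The constant is [2 (9 l^2 + 6 l)]: [9 l^2] bounds the remainder of the exponential at [l / q],
   [6 l] the cost of replacing [l / q] by [3 l / n]. *)
exists (18 * l ^+ 2 + 12 * l); exists 1%N => //= n /= n1.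
rewrite ceil_div3 -pmulrn.
set q := ((n + 2) %/ 3)%N.
have nq : n%:R <= 3 * q%:R :> R by rewrite -natrM ler_nat /q; lia.
have qn : 3 * q%:R <= n%:R + 2 :> R by rewrite -natrM -natrD ler_nat /q; lia.
have n_gt0 : 0 < n%:R :> R by rewrite ltr0n.
have q_gt0 : 0 < q%:R :> R by lra.
have iq : q%:R^-1 <= 3 / n%:R :> R.
  by rewrite ler_pdivlMr // mulrC ler_pdivrMr.
have -> : 2 `^ (1 - 1 / q%:R) = 2 * expR (- (l / q%:R)) :> R.
  rewrite powRD ?pnatr_eq0 ?implybT // powRr1 ?ler0n // /powR pnatr_eq0 /=.
  by rewrite -/l mul1r mulNr [_ * l]mulrC.
set x := l / q%:R.
have x0 : 0 <= x by rewrite divr_ge0 // ltW.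
have xn : x <= 3 * l / n%:R.
  by rewrite [3 * l]mulrC -mulrA ler_wpM2l.
(* The difference is [- l (3 q - n) / (n q)], where [3 q - n <= 2] and [1 / q <= 3 / n]. *)
have xl : `| x - 3 * l / n%:R | <= 6 * l / n%:R ^+ 2.
  have -> : x - 3 * l / n%:R = - ((l / n%:R) * (3 * q%:R - n%:R) / q%:R).
    by rewrite /x; field; rewrite !gt_eqF.
  rewrite normrN ger0_norm; last first.
    by rewrite mulr_ge0 ?invr_ge0 ?mulr_ge0 ?subr_ge0 ?invr_ge0 // ltW.
  have -> : 6 * l / n%:R ^+ 2 = (l / n%:R) * 2 * (3 / n%:R).
    by field; rewrite gt_eqF.
  have ln0 : 0 <= l / n%:R by rewrite divr_ge0 // ltW.
  apply: ler_pM => //.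
  - by rewrite mulr_ge0 // subr_ge0.
  - by rewrite ler_wpM2l // lerBlDl.
have x2 : x ^+ 2 <= 9 * l ^+ 2 / n%:R ^+ 2.
  have -> : 9 * l ^+ 2 / n%:R ^+ 2 = (3 * l / n%:R) ^+ 2.
    by field; rewrite gt_eqF.
  by rewrite ler_pXn2r // nnegrE // divr_ge0 ?mulr_ge0 // ltW.
have -> : 2 * expR (- x) - (2 - 6 * l / n%:R) =
    2 * ((expR (- x) - (1 - x)) - (x - 3 * l / n%:R)) by ring.
have -> : (18 * l ^+ 2 + 12 * l) * (1 / n%:R ^+ 2) =
    2 * (9 * l ^+ 2 / n%:R ^+ 2 + 6 * l / n%:R ^+ 2) by ring.
rewrite normrM ger0_norm // ler_pM2l //.
apply: le_trans (ler_normB _ _) _.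
by apply: lerD => //; apply: le_trans x2; exact: expRN_bound.
Qed.
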